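(* Let $a\neq0$ be a real number and let $F$ be a finite set of positive integers. Assume that $\Omega_F^a(n)\neq0$ for all nonnegative integers $n$. Then the polynomials $c_n^{a;F}$, $n\in\sigma_F$, are orthogonal with respect to the (possibly signed) discrete measure $$\omega_{a;F}=\sum_{x=0}^\infty\frac{a^x}{x!\,\Omega_F^a(x)\,\Omega_F^a(x+1)}\,\delta_x .$$ Moreover, for $a<0$ the measure $\omega_{a;F}$ is never positive, and for $a>0$ the measure $\omega_{a;F}$ is positive if and only if $F$ is admissible.
   Context: Charlier polynomials ($a\ne0$): $c_n^a(x)=\frac1{n!}\sum_{j=0}^n(-a)^{n-j}\binom nj\binom xj j!$, $n\ge0$. For $F=\{f_1<\cdots<f_k\}$ put $u_F=\sum_{f\in F}f-\binom{k+1}{2}$ and $\sigma_F=\{u_F,u_F+1,u_F+2,\dots\}\setminus\{u_F+f: f\in F\}$. For $n\in\sigma_F$, $c_n^{a;F}(x)$ is the $(k+1)\times(k+1)$ determinant whose first row is $(c^a_{n-u_F}(x+j))_{j=0}^{k}$ and whose $(i+1)$-th row is $(c^a_{f_i}(x+j))_{j=0}^k$, $i=1,\dots,k$. Also $\Omega_F^a(x)=\det\big(c_{f_i}^a(x+j-1)\big)_{i,j=1}^k$. Orthogonal with respect to a measure $\mu$ means $\int p_np_m\,d\mu=0$ for all $n\ne m$ in the index set. Admissible: write $F=\bigcup_{i=1}^KY_i$ as a disjoint union where the elements of each $Y_i$ are consecutive integers and $1+\max Y_i<\min Y_{i+1}$ for $i=1,\dots,K-1$ (the decomposition of $F$ into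 maximal blocks of consecutive integers). $F$ is admissible if every $Y_i$ has an even number of elements. *)

(* Defs.v *)
From HB Require Import structures.
From mathcomp Require Import all_boot all_order all_algebra.
From mathcomp Require Import finmap.
From mathcomp Require Import all_classical all_reals all_analysis.

Set Implicit Arguments.
Unset Strict Implicit.
Unset Printing Implicit Defensive.

Import Order.TTheory GRing.Theory Num.Theory.
Import numFieldNormedType.Exports.

Local Open Scope classical_set_scope.
Local Open Scope ring_scope.

Definition bin_poly (R : realType) (j : nat) : {poly R} :=
  (j`!%:R)^-1 *: \prod_(i < j) ('X - (i%:R)%:P).

Definition charlier (R : realType) (a : R) (n : nat) : {poly R} :=
  (n`!%:R)^-1 *:
    \sum_(j < n.+1) ((- a) ^+ (n - j) * 'C(n, j)%:R * j`!%:R) *: bin_poly R j.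

(* p(x) |-> p(x + j) *)
Definition shift_poly (R : realType) (j : nat) (p : {poly R}) : {poly R} :=
  p \Po ('X + (j%:R)%:P).

(* f_1 < ... < f_k, so that f_i is [nth 0 (elems F) i.-1] *)
Definition elems (F : {fset nat}) : seq nat := sort leq (enum_fset F).

(* The truncated subtraction is exact when F consists of positive integers,
   since then the sum is at least 1 + ... + k. *)
Definition uF (F : {fset nat}) : nat :=
  (\sum_(f <- elems F) f - 'C(#|` F|.+1, 2))%N.

Definition sigmaF (F : {fset nat}) : set nat :=
  [set n | (uF F <= n)%N] `\` [set (uF F + f)%N | f in [set f | f \in F]].

(* Row 0 carries the index n - u_F and row i >= 1 carries f_i. *)
Definition xcharlier (R : realType) (a : R) (F : {fset nat}) (n : nat) :
    {poly R} :=
  \det (\matrix_(i < #|` F|.+1, j < #|` F|.+1)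
    shift_poly j (charlier a (nth 0%N ((n - uF F)%N :: elems F) i))).

(* 0-based indices: the shift j - 1 of the 1-based formula becomes j. *)
Definition Omega (R : realType) (a : R) (F : {fset nat}) : {poly R} :=
  \det (\matrix_(i < #|` F|, j < #|` F|)
    shift_poly j (charlier a (nth 0%N (elems F) i))).

Definition omega_mass (R : realType) (a : R) (F : {fset nat}) (x : nat) : R :=
  a ^+ x / (x`!%:R * (Omega a F).[x%:R] * (Omega a F).[x.+1%:R]).

(* [nu] is the signed measure \sum_(x >= 0) w x *: \d_x on the real line.
   Since the series is required to converge on every measurable set,
   this forces w to be absolutely summable. *)
Definition is_discrete_charge (R : realType) (w : nat -> R)
    (nu : {charge set (measurableTypeR R) -> \bar R}) : Prop :=
  forall A : set (measurableTypeR R), measurable A ->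
    (fun n => \sum_(0 <= x < n) (w x)%:E * \d_(x%:R : measurableTypeR R) A)%E
      @ \oo --> nu A.

(* Integration against a signed measure through its Jordan decomposition,
   which does not depend on the chosen Hahn decomposition. *)
Definition charge_has_integral (d : measure_display) (T : measurableType d)
    (R : realType) (nu : {charge set T -> \bar R}) (f : T -> \bar R)
    (v : \bar R) : Prop :=
  forall (P N : set T) (nuPN : hahn_decomposition nu P N),
    [/\ (jordan_pos nuPN).-integrable setT f,
        (jordan_neg nuPN).-integrable setT f &
        (\int[jordan_pos nuPN]_x f x - \int[jordan_neg nuPN]_x f x)%E = v].

Definition orthogonal_family (R : realType)
    (nu : {charge set (measurableTypeR R) -> \bar R})
    (I : set nat) (p : nat -> {poly R}) : Prop :=
  forall n m : nat, I n -> I m -> n <> m ->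
    charge_has_integral nu (fun x => ((p n).[x] * (p m).[x])%:E) 0%E.

Definition positive_charge (d : measure_display) (T : measurableType d)
    (R : realType) (nu : {charge set T -> \bar R}) : Prop :=
  positive_set nu setT.

Definition consecutive (Y : {fset nat}) : Prop :=
  Y != fset0 /\ exists m : nat, elems Y = iota m #|` Y|.

Definition is_block_decomposition (F : {fset nat}) (Ys : seq {fset nat}) :
    Prop :=
  [/\ F = (\bigcup_(Y <- Ys) Y)%fset,
      pairwise (fun A B : {fset nat} => [disjoint A & B]%fset) Ys,
      (forall Y, Y \in Ys -> consecutive Y) &
      sorted (fun A B : {fset nat} =>
        (1 + last 0 (elems A) < head 0 (elems B))%N) Ys].

(* A block decomposition exists and is unique; the empty set is admissible. *)
Definition admissible (F : {fset nat}) : Prop :=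
  exists Ys : seq {fset nat},
    is_block_decomposition F Ys /\ (forall Y, Y \in Ys -> ~~ odd #|` Y|).

(* Main.v *)
Require Import Defs.
From HB Require Import structures.
From mathcomp Require Import all_boot all_order all_algebra.
From mathcomp Require Import finmap.
From mathcomp Require Import all_classical all_reals all_analysis.
From mathcomp Require Import measurable_realfun ring lra zify.
From mathcomp Require polyrcf.

Set Implicit Arguments.
Unset Strict Implicit.
Unset Printing Implicit Defensive.

Import Order.TTheory GRing.Theory Num.Theory.
Import numFieldNormedType.Exports.

Local Open Scope classical_set_scope.
Local Open Scope ring_scope.

(** The functions [c_n] are eigenfunctions, with eigenvalue [n], of a second
    order difference operator in [x]. Write [W_m], [V] and [O] for the Casorati
    determinants of the families [m, F], [m, l, F] and [F]. Expanding a double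
    sum of cofactors in two ways and using the difference equation gives
      (m - l) W_m(x) W_l(x) = a V(x) O(x) - x V(x-1) O(x+1).
    After division by [x! O(x) O(x+1) / a^x] the right-hand side telescopes,
    with vanishing boundary terms; this is the orthogonality.

    For [a > 0], duality [c_n(x) ~ c_x(n)] turns [O(x)] into a determinant of
    the polynomials [c_(x+j)] at the points of [F], and the Christoffel formula
    produces polynomials [q_x] of degree [x], orthogonal for the Poisson weight
    times [A(n) = prod_(f in F) (n - f)], with squared norm a positive multiple
    of [O(x) O(x+1)]. If [A >= 0] on the naturals, all these norms are
    nonnegative. Conversely, if they are nonnegative, so is the integral of
    [A p^2] for each polynomial [p]; letting [p] approximate the indicator of
    [n] gives [A(n) >= 0]. Finally the sign of [A(n)] is the parity of the
    number of elements of [F] above [n]. For [a < 0], [O] has constant sign far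
    out while [a^x] alternates. *)

(** * Charlier polynomials *)

Section CharlierPolynomials.
Variables (R : realType) (a : R).
Implicit Types (y : R) (n j : nat).

Lemma shift_polyE j (p : {poly R}) y : (shift_poly j p).[y] = p.[y + j%:R].
Proof. by rewrite /shift_poly horner_comp !hornerE. Qed.

Lemma factr_neq0 n : n`!%:R != 0 :> R.
Proof. by rewrite pnatr_eq0 -lt0n fact_gt0. Qed.

Lemma bin_polyE j y :
  (bin_poly R j).[y] = (j`!%:R)^-1 * \prod_(i < j) (y - i%:R).
Proof.
rewrite /bin_poly hornerZ horner_prod; congr (_ * _).
by apply: eq_bigr => i _; rewrite !hornerE.
Qed.

Lemma bin_poly0 y : (bin_poly R 0).[y] = 1.
Proof. by rewrite bin_polyE big_ord0 fact0 invr1 mulr1. Qed.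

Lemma bin_poly_mulX j y :
  y * (bin_poly R j).[y - 1] = j.+1%:R * (bin_poly R j.+1).[y].
Proof.
rewrite !bin_polyE big_ord_recl /= subr0 factS natrM invfM mulrCA.
rewrite (eq_bigr (fun i : 'I_j => y - (bump 0 i)%:R)); last first.
  by move=> i _; rewrite /bump /= add1n -natr1; ring.
have nz : j.+1%:R != 0 :> R by rewrite pnatr_eq0.
by field; rewrite factr_neq0 nat1r.
Qed.

Lemma bin_poly_diff j y :
  (bin_poly R j.+1).[y + 1] - (bin_poly R j.+1).[y] = (bin_poly R j).[y].
Proof.
have nz : j.+1%:R != 0 :> R by rewrite pnatr_eq0.
apply: (mulfI nz); rewrite mulrBr -bin_poly_mulX addrK.
rewrite !bin_polyE big_ord_recr /= factS natrM invfM -[j.+1%:R]natr1.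
by field; rewrite factr_neq0 natr1.
Qed.

(** In this form the value is the coefficient of [t ^ n] in the generating function
    [exp(- a t) (1 + t) ^ y]. *)
Lemma charlierE n y :
  (charlier a n).[y] = \sum_(j < n.+1) exp_coeff (- a) (n - j)%N * (bin_poly R j).[y].
Proof.
rewrite /charlier hornerZ horner_sum big_distrr /=.
apply: eq_bigr => j _; rewrite hornerZ mulrA; congr (_ * _).
have jn : (j <= n)%N by rewrite -ltnS.
rewrite /exp_coeff /= -(bin_fact jn) !natrM !invfM.
have b0 : 'C(n, j)%:R != 0 :> R by rewrite pnatr_eq0 -lt0n bin_gt0.
by field; rewrite !factr_neq0 b0.
Qed.

Lemma charlier0 y : (charlier a 0).[y] = 1.
Proof. by rewrite charlierE big_ord1 bin_poly0 /exp_coeff /= expr0 fact0 divr1 mulr1. Qed.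

Lemma charlier_diff n y :
  (charlier a n.+1).[y + 1] - (charlier a n.+1).[y] = (charlier a n).[y].
Proof.
rewrite !charlierE big_ord_recl [in X in _ - X]big_ord_recl !bin_poly0.
rewrite opprD addrACA subrr add0r -sumrB; apply: eq_bigr => j _.
by rewrite -mulrBr bin_poly_diff.
Qed.

Lemma charlier_raise n y :
  y * (charlier a n).[y - 1] - a * (charlier a n).[y] =
  n.+1%:R * (charlier a n.+1).[y].
Proof.
rewrite !charlierE.
(* Split [n.+1 = j + (n.+1 - j)]: the first part matches the sum at [y - 1] through [bin_poly_mulX],
   the second lowers the exponential coefficient and yields the factor [- a]. *)
have -> : n.+1%:R * \sum_(j < n.+2) exp_coeff (- a) (n.+1 - j)%N * (bin_poly R j).[y] =
  \sum_(j < n.+2) exp_coeff (- a) (n.+1 - j)%N * (j%:R * (bin_poly R j).[y]) +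
  \sum_(j < n.+2) (n.+1 - j)%:R * exp_coeff (- a) (n.+1 - j)%N * (bin_poly R j).[y].
  rewrite -big_split big_distrr /=; apply: eq_bigr => j _.
  have jn : (j <= n.+1)%N by rewrite -ltnS.
  by rewrite natrB //; ring.
congr (_ + _).
  rewrite [RHS]big_ord_recl /= mul0r mulr0 add0r big_distrr /=.
  by apply: eq_bigr => j _; rewrite mulrCA bin_poly_mulX.
rewrite [RHS]big_ord_recr /= subnn !mul0r addr0 big_distrr -sumrN /=.
apply: eq_bigr => j _; have jn : (j <= n)%N by rewrite -ltnS.
rewrite subSn // /exp_coeff /= factS natrM invfM exprS.
by field; rewrite factr_neq0 nat1r pnatr_eq0.
Qed.

(** The raising relation composed with the forward difference, which lowers the index, returns to
    the index [n]. *)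
Lemma charlier_eigen n y :
  y * (charlier a n).[y - 1] + a * (charlier a n).[y + 1] =
  (y + a - n%:R) * (charlier a n).[y].
Proof.
case: n => [|n]; first by rewrite !charlier0; ring.
have := charlier_raise n y; have := charlier_diff n y.
have := charlier_diff n (y - 1); rewrite subrK => <- <- E.
by rewrite mulrBl -E; ring.
Qed.

Lemma bin_poly_nat j n : (bin_poly R j).[n%:R] = 'C(n, j)%:R.
Proof.
elim: n j => [|n IH] [|j]; rewrite ?bin_poly0 ?bin0 //.
  by rewrite bin_polyE big_ord_recl subrr mul0r mulr0 bin0n.
by have := bin_poly_diff j n%:R; rewrite natr1 !IH binS natrD => <-; rewrite subrKC.
Qed.

Lemma size_bin_poly j : size (bin_poly R j) = j.+1.
Proof.
rewrite /bin_poly size_scale ?invr_eq0 ?factr_neq0 // size_prod_XsubC.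
by rewrite -[index_enum _]enumT size_enum_ord.
Qed.

Lemma lead_coef_bin_poly j : lead_coef (bin_poly R j) = (j`!%:R)^-1.
Proof.
rewrite /bin_poly lead_coefZ (monicP _) ?mulr1 //; exact: monic_prod_XsubC.
Qed.

Lemma charlier_size_lead n :
  size (charlier a n) = n.+1 /\ lead_coef (charlier a n) = (n`!%:R)^-1.
Proof.
rewrite /charlier size_scale ?invr_eq0 ?factr_neq0 // lead_coefZ.
rewrite big_ord_recr /= subnn expr0 binn !mul1r addrC.
set p := _ *: bin_poly R n; set q := \sum_(_ < _) _.
have sp : size p = n.+1 by rewrite size_scale ?factr_neq0 // size_bin_poly.
have qp : (size q < size p)%N.
  rewrite sp ltnS; apply: (leq_trans (size_sum _ _ _)); apply/bigmax_leqP => i _.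
  by apply: (leq_trans (size_scale_leq _ _)); rewrite size_bin_poly.
rewrite size_polyDl // lead_coefDl // lead_coefZ lead_coef_bin_poly.
by rewrite divff ?factr_neq0 // mulr1.
Qed.

(** The hypergeometric normalisation [2F0(-n, -x; ; -1/a)], with value [1] at [0]; it makes degree
    and variable interchangeable on the naturals. *)
Definition dual_charlier n : {poly R} := (n`!%:R / (- a) ^+ n) *: charlier a n.

Hypothesis a_neq0 : a != 0.

Lemma expNa_neq0 n : (- a) ^+ n != 0.
Proof. by rewrite expf_neq0 // oppr_eq0. Qed.

Lemma size_dual_charlier n : size (dual_charlier n) = n.+1.
Proof.
rewrite /dual_charlier size_scale; first by have [] := charlier_size_lead n.
by rewrite mulf_neq0 ?invr_eq0 ?factr_neq0 ?expNa_neq0.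
Qed.

Lemma lead_coef_dual_charlier n : lead_coef (dual_charlier n) = ((- a) ^+ n)^-1.
Proof.
rewrite /dual_charlier lead_coefZ; have [_ ->] := charlier_size_lead n.
by rewrite mulrAC divff ?factr_neq0 // mul1r.
Qed.

(** The summand is symmetric in [n] and [m]; a bound [N] beyond the degree only adds zero terms and
    lets both orders share one index range. *)
Lemma dual_charlier_sum N n m : (n <= N)%N -> (dual_charlier n).[m%:R] =
  \sum_(j < N.+1) 'C(n, j)%:R * 'C(m, j)%:R * j`!%:R / (- a) ^+ j.
Proof.
move=> nN; rewrite /dual_charlier hornerZ charlierE.
rewrite (big_ord_widen N.+1 (fun j => exp_coeff (- a) (n - j)%N *
  (bin_poly R j).[m%:R])) // big_mkcond mulr_sumr; apply: eq_bigr => j _.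
have [jn|jn] := ifPn; last by rewrite bin_small ?mulr0 ?mul0r // ltnNge -ltnS.
have {}jn : (j <= n)%N by rewrite -ltnS.
rewrite bin_poly_nat /exp_coeff /= -(bin_fact jn) !natrM.
have -> : (- a) ^+ n = (- a) ^+ (n - j) * (- a) ^+ j by rewrite -exprD subnK.
have aj := expNa_neq0 j; have anj := expNa_neq0 (n - j)%N.
by field; rewrite aj anj factr_neq0.
Qed.

Lemma dual_charlierC n m : (dual_charlier n).[m%:R] = (dual_charlier m).[n%:R].
Proof.
rewrite (@dual_charlier_sum (n + m)) ?leq_addr //.
rewrite (@dual_charlier_sum (n + m)) ?leq_addl //.
by apply: eq_bigr => j _; ring.
Qed.

End CharlierPolynomials.

(** * The telescoping identity *)

Section CasoratiIdentity.
Variables (R : comNzRingType) (k : nat).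

Lemma sum_ord2 (V : nmodType) (f : 'I_k.+2 -> V) :
  (forall i : 'I_k, f (lift ord0 (lift ord0 i)) = 0) ->
  \sum_i f i = f ord0 + f (lift ord0 ord0).
Proof.
move=> f0; by rewrite !big_ord_recl /= [X in _ + (_ + X)]big1 ?addr0.
Qed.

(* Row [i] of the Casorati matrix holds an eigenfunction with eigenvalue [e i],
   column [j] its value at the [j]-th node; the second order equation couples
   three consecutive columns. The sum of [N i * e i * g i j.+1 * z j] over [i]
   and [j], with [N] and [z] cofactors, is evaluated in both orders. *)
Lemma casorati_identity (g : 'I_k.+2 -> nat -> R) (e : 'I_k.+2 -> R)
    (b d : nat -> R) (a : R)
    (seed := fun i : 'I_k => lift ord0 (lift ord0 i) : 'I_k.+2)
    (W := fun r : 'I_k.+2 => \det (\matrix_(i < k.+1, j < k.+1)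
       g (oapp seed r (unlift ord0 i)) j.+1)) :
  (forall i j, b j * g i j + a * g i j.+2 = (d j - e i) * g i j.+1) ->
  (e ord0 - e (lift ord0 ord0)) * (W ord0 * W (lift ord0 ord0)) =
  a * \det (\matrix_(i < k.+2, j < k.+2) g i j.+1) *
      \det (\matrix_(i < k, j < k) g (seed i) j.+1) -
  b 0%N * \det (\matrix_(i < k.+2, j < k.+2) g i j) *
      \det (\matrix_(i < k, j < k) g (seed i) j.+2).
Proof.
move=> rec.
(* The [N i] are the cofactors of a column prepended to the columns [1, ..., k.+1], so pairing them
   with [v] inserts [v] as that column. *)
pose m (i : 'I_k.+2) := \det (\matrix_(i' < k.+1, j < k.+1) g (lift i i') j.+1).
pose N (i : 'I_k.+2) := (-1) ^+ i * m i.
have colE (v : 'I_k.+2 -> R) : \sum_i N i * v i =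
    \det (\matrix_(i < k.+2, j < k.+2) oapp (fun j : 'I_k.+1 => g i j.+1) (v i)
            (unlift ord0 j)).
  rewrite (expand_det_col _ ord0); apply: eq_bigr => i _.
  rewrite mxE unlift_none /= /cofactor addn0 mulrC; congr (_ * (_ * \det _)).
  by apply/matrixP => i' j; rewrite !mxE liftK.
have N0 j : (j < k.+1)%N -> \sum_i N i * g i j.+1 = 0.
  move=> jk; rewrite colE -det_tr.
  pose j' := lift ord0 (Ordinal jk).
  apply: (@determinant_alternate _ _ _ ord0 j') => // i.
  by rewrite !mxE unlift_none liftK.
have V0 : \sum_i N i * g i 0%N = \det (\matrix_(i < k.+2, j < k.+2) g i j).
  rewrite colE; congr (\det _); apply/matrixP => i j; rewrite !mxE.
  by case: (unliftP ord0 j) => [j'|] ->.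
(* The sign comes from moving the inserted column past the [k.+1] others to the last place. *)
have V1 : \sum_i N i * g i k.+2 =
    (-1) ^+ k.+1 * \det (\matrix_(i < k.+2, j < k.+2) g i j.+1).
  rewrite (expand_det_col _ ord_max) big_distrr; apply: eq_bigr => i _ /=.
  rewrite mxE /= /cofactor /= mulrCA mulrC; congr (_ * _).
  rewrite exprD mulrA mulrA -[_ * (-1) ^+ i * _]mulrA [_ * _ ^+ k.+1]mulrC.
  rewrite mulrA -exprD addnn -mul2n exprM sqrrN !expr1n mul1r; congr (_ * \det _).
  by apply/matrixP => i' j; rewrite !mxE lift_max.
(* The [z j] are the cofactors of the first row in [W r]; they involve only the seed rows. *)
pose z (j : 'I_k.+1) := (-1) ^+ j *
  \det (\matrix_(i < k, j' < k) g (seed i) (lift j j').+1).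
have WE r : \sum_(j < k.+1) g r j.+1 * z j = W r.
  rewrite /W (expand_det_row _ ord0); apply: eq_bigr => j _.
  rewrite mxE unlift_none /= /cofactor add0n; congr (_ * (_ * \det _)).
  by apply/matrixP => i' j'; rewrite !mxE liftK.
have W0 i : W (seed i) = 0.
  rewrite /W; apply: (@determinant_alternate _ _ _ ord0 (lift ord0 i)) => // j.
  by rewrite !mxE unlift_none liftK.
have z0 : z ord0 = \det (\matrix_(i < k, j < k) g (seed i) j.+2).
  by rewrite /z expr0 mul1r.
have zk : z ord_max = (-1) ^+ k * \det (\matrix_(i < k, j < k) g (seed i) j.+1).
  rewrite /z /=; congr (_ * \det _); apply/matrixP => i j.
  by rewrite !mxE /= /bump leqNgt ltn_ord.
(* Deleting one of the two distinguished rows leaves the Casoratian of the other. *)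
have NW0 : N ord0 = W (lift ord0 ord0).
  rewrite /N expr0 mul1r; congr (\det _); apply/matrixP => i j; rewrite !mxE.
  by case: (unliftP ord0 i) => [i'|] ->.
have NW1 : N (lift ord0 ord0) = - W ord0.
  rewrite /N /= expr1 mulN1r; congr (- \det _); apply/matrixP => i j; rewrite !mxE.
  by case: (unliftP ord0 i) => [i'|] -> /=; congr (g _ _); apply: val_inj.
(* Summing over [j] first: seed rows drop out because [W] then has a repeated row. *)
have S1 : \sum_i \sum_(j < k.+1) N i * e i * (g i j.+1 * z j) =
    (e ord0 - e (lift ord0 ord0)) * (W ord0 * W (lift ord0 ord0)).
  under eq_bigr => i _ do rewrite -big_distrr WE.
  rewrite sum_ord2 /= => [|i]; last by rewrite W0 mulr0.
  rewrite NW0 NW1; ring.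
rewrite -S1 exchange_big /=.
have S2 (j : 'I_k.+1) : \sum_i N i * e i * (g i j.+1 * z j) =
    - (b j * \sum_i N i * g i j + a * \sum_i N i * g i j.+2) * z j.
  rewrite !big_distrr -big_split -sumrN big_distrl /=.
  (* The [d j] term of the recurrence can be added freely, since [N] annihilates column [j.+1]. *)
  have -> : \sum_i N i * e i * (g i j.+1 * z j) =
      \sum_i (N i * e i * (g i j.+1 * z j) - d j * z j * (N i * g i j.+1)).
    by rewrite sumrB -big_distrr N0 //= mulr0 subr0.
  apply: eq_bigr => i _.
  have -> : b j * (N i * g i j) + a * (N i * g i j.+2) =
    N i * (b j * g i j + a * g i j.+2) by ring.
  by rewrite rec; ring.
rewrite (eq_bigr _ (fun j _ => S2 j)).
have -> : \sum_(j < k.+1) - (b j * (\sum_i N i * g i j) +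
      a * (\sum_i N i * g i j.+2)) * z j =
   - (\sum_(j < k.+1) b j * (\sum_i N i * g i j) * z j) -
     \sum_(j < k.+1) a * (\sum_i N i * g i j.+2) * z j.
  by rewrite -opprD -big_split -sumrN; apply: eq_bigr => j _ /=; ring.
(* Among the columns [0, ..., k.+2] only the two extreme ones escape [N0], so each sum keeps a
   single boundary term. *)
have -> : \sum_(j < k.+1) b j * (\sum_i N i * g i j) * z j =
    b 0%N * (\sum_i N i * g i 0%N) * z ord0.
  rewrite big_ord_recl /= [X in _ + X = _]big1 ?addr0 // => j _.
  by rewrite N0 ?mulr0 ?mul0r // ltnW // ltnS.
have -> : \sum_(j < k.+1) a * (\sum_i N i * g i j.+2) * z j =
    a * (\sum_i N i * g i k.+2) * z ord_max.
  rewrite big_ord_recr /= [X in X + _ = _]big1 ?add0r // => j _.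
  by rewrite N0 ?mulr0 ?mul0r // ltnS.
rewrite V0 V1 z0 zk addrC; congr (_ - _); rewrite exprS mulN1r.
have : (-1) ^+ k * (-1) ^+ k = 1 :> R by rewrite -expr2 sqrr_sign.
move: ((-1) ^+ k) => s ss.
set A := \det _; set B := \det _.
have -> : - (a * (- s * A) * (s * B)) = (s * s) * (a * A * B) by ring.
by rewrite ss mul1r.
Qed.

End CasoratiIdentity.

(** * Exponentially small sequences *)

Section ExponentialDecay.
Variable R : realType.
Implicit Types (u v : nat -> R) (p : {poly R}).

(** The free base [D] makes this class stable under multiplication by sequences of geometric growth,
    polynomial values in particular. *)
Definition exp_dominated u :=
  exists C D : R, 0 <= D /\ forall n, `|u n| <= C * exp_coeff D n.

Lemma exp_dominated_series u :
  exp_dominated u -> cvgn (series (fun n => `|u n|)).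
Proof.
move=> [C [D [D0 uCD]]].
apply: (@series_le_cvg _ _ (C *: exp_coeff D)) => //.
- by move=> n; exact: le_trans (uCD n).
- by apply: is_cvg_seriesZ; exact: is_cvg_series_exp_coeff.
Qed.

Lemma exp_dominated_cvg u : exp_dominated u -> cvgn (series u).
Proof. by move=> /exp_dominated_series; exact: normed_cvg. Qed.

Lemma exp_dominated_cvg0 u : exp_dominated u -> u @ \oo --> 0.
Proof. by move=> /exp_dominated_cvg; exact: cvg_series_cvg_0. Qed.

Lemma exp_dominated_bounded u v (K : R) :
  (forall n, `|v n| <= K) -> exp_dominated u ->
  exp_dominated (fun n => u n * v n).
Proof.
move=> vK [C [D [D0 uCD]]]; exists (C * K), D; split => // n.
rewrite normrM mulrAC; apply: ler_pM => //.
Qed.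

Lemma exp_dominated_geometric u (K E : R) v : 0 <= E ->
  (forall n, `|v n| <= K * E ^+ n) -> exp_dominated u ->
  exp_dominated (fun n => u n * v n).
Proof.
move=> E0 vK [C [D [D0 uCD]]]; exists (C * K), (D * E).
split=> [|n]; first exact: mulr_ge0.
rewrite normrM; apply: (le_trans (ler_pM _ _ (uCD n) (vK n))) => //.
rewrite /exp_coeff /= exprMn.
by rewrite (_ : C * K * _ = C * (D ^+ n / n`!%:R) * (K * E ^+ n)) //; ring.
Qed.

Lemma horner_nat_bound p :
  exists C D : R, 0 <= D /\ forall n : nat, `|p.[n%:R]| <= C * D ^+ n.
Proof.
elim/poly_ind: p => [|p c [C [D [D0 pCD]]]].
  by exists 0, 0; split => // n; rewrite horner0 normr0 mul0r.
have C0 : 0 <= C.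
  by have := pCD 0%N; rewrite expr0 mulr1; exact: le_trans.
exists (C + `|c|), (2 * (D + 1)); split => [|n]; first nra.
rewrite hornerMXaddC mulrDl; apply: (le_trans (ler_normD _ _)); apply: lerD.
  rewrite normrM normr_nat exprMn.
  have n2 : n%:R <= 2 ^+ n :> R by rewrite -natrX ler_nat ltnW // ltn_expl.
  rewrite mulrC mulrCA; apply: ler_pM => //.
  apply: le_trans (pCD n) _; apply: ler_wpM2l => //.
  by apply: lerXn2r; rewrite ?nnegrE //; lra.
by rewrite ler_peMr // exprn_ege1 //; lra.
Qed.

Lemma exp_dominated_horner u p :
  exp_dominated u -> exp_dominated (fun n => u n * p.[n%:R]).
Proof.
have [C [D [D0 pCD]]] := horner_nat_bound p.
exact: exp_dominated_geometric pCD.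
Qed.

Lemma exp_dominated_exp_coeff (a : R) : exp_dominated (exp_coeff a).
Proof.
exists 1, `|a|; split => // n.
by rewrite mul1r /exp_coeff /= normrM normrX normfV normr_nat.
Qed.

(** Up to sign the leading coefficient is positive and the values are eventually at least it. The
    first clause serves to bound inverses, the second to fix signs far out. *)
Lemma horner_eventually p : p != 0 ->
  exists2 N : nat, exists2 d : R, 0 < d & forall n, (N <= n)%N -> d <= `|p.[n%:R]|
  & forall n, (N <= n)%N -> 0 < p.[n%:R] * p.[n.+1%:R].
Proof.
move=> p0.
wlog lp : p p0 / 0 < lead_coef p.
  move=> H; have [l0|] := ltrP 0 (lead_coef p); first exact: H.
  rewrite le_eqVlt lead_coef_eq0 (negPf p0) /= => l0.
  have [| |N [d d0 Nd] Np] := H (- p); rewrite ?oppr_eq0 ?lead_coefN ?oppr_gt0 //.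
  exists N => [|n nN].
    by exists d => // n nN; have := Nd n nN; rewrite hornerN normrN.
  by have := Np n nN; rewrite !hornerN mulrNN.
have [M pM] := polyrcf.poly_pinfty_gt_lc lp.
have [N MN] : exists N : nat, M <= N%:R.
  exists (Num.bound `|M|); apply: le_trans (ler_norm _) _.
  exact/ltW/archi_boundP.
have pN n : (N <= n)%N -> lead_coef p <= p.[n%:R].
  by move=> nN; apply: pM; apply: le_trans MN _; rewrite ler_nat.
exists N => [|n nN].
  by exists (lead_coef p) => // n nN; apply: le_trans (pN _ nN) (ler_norm _).
by apply: mulr_gt0; apply: (lt_le_trans lp); apply: pN => //; exact: leqW.
Qed.

Lemma horner_inv_bound p : (forall n : nat, p.[n%:R] != 0) ->
  exists K : R, forall n : nat, `|p.[n%:R]^-1| <= K.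
Proof.
move=> pn; have p0 : p != 0.
  by apply: contraNneq (pn 0%N) => ->; rewrite horner0.
have [N [d d0 Nd] _] := horner_eventually p0.
(* [d^-1] covers the indices from [N] on, the finite sum those below. *)
exists (d^-1 + \sum_(n < N) `|p.[n%:R]^-1|) => n.
have S0 : 0 <= \sum_(n < N) `|p.[n%:R]^-1| by apply: sumr_ge0.
have [nN|Nn] := ltnP n N.
  rewrite (bigD1 (Ordinal nN)) //= addrCA lerDl.
  by apply: addr_ge0; rewrite ?sumr_ge0 ?invr_ge0 // ltW.
apply: ler_wpDr => //; rewrite normfV lef_pV2 ?posrE ?normr_gt0 //.
exact: Nd.
Qed.

End ExponentialDecay.

(** * Discrete charges and their integrals *)

Section AtomicCharge.
Variable R : realType.
Local Notation T := (measurableTypeR R).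
Implicit Types (w : nat -> R) (v : nat -> {nonneg R}).

Definition atomic v : set T -> \bar R :=
  mseries (fun n => mscale (v n) \d_(n%:R : T)) 0.

HB.instance Definition _ v := Measure.on (atomic v).

Lemma nneseries_EFin (u : nat -> R) : cvgn (series u) ->
  (\sum_(n <oo) (u n)%:E)%E = (limn (series u))%:E.
Proof.
move=> cu; apply/cvg_lim => //.
under eq_fun do rewrite sumEFin.
by apply: cvg_EFin => //; exact: nearW.
Qed.

Lemma atomicE v A : atomic v A = (\sum_(n <oo) ((v n)%:num * (n%:R \in A)%:R)%:E)%E.
Proof.
by rewrite /atomic /mseries; apply: eq_eseriesr => n _; rewrite /mscale.
Qed.

Lemma ge0_integral_atomic v (f : T -> R) :
  measurable_fun [set: T] f -> (forall x, 0 <= f x) ->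
  (\int[atomic v]_x (f x)%:E = \sum_(n <oo) ((v n)%:num * f n%:R)%:E)%E.
Proof.
move=> mf f0; have /measurable_EFinP mEf := mf.
rewrite ge0_integral_measure_series //; last by move=> t _; rewrite lee_fin.
apply: eq_eseriesr => n _.
rewrite ge0_integral_mscale //; last by move=> t _; rewrite lee_fin.
by rewrite integral_dirac // diracT mul1e.
Qed.

Lemma integral_atomic v (f : T -> R) : measurable_fun [set: T] f ->
  cvgn (series (fun n => `|(v n)%:num * f n%:R|)) ->
  (atomic v).-integrable setT (fun x => (f x)%:E) /\
  (\int[atomic v]_x (f x)%:E = (limn (series (fun n => (v n)%:num * f n%:R)))%:E)%E.
Proof.
move=> mf cf; split.
  apply/integrableP; split; first exact/measurable_EFinP.
  rewrite (ge0_integral_atomic _ (f := fun x => `|f x|)) //; last first.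
    exact: measurableT_comp.
  under eq_eseriesr => n _ do rewrite -[(v n)%:num]ger0_norm // -normrM.
  by rewrite nneseries_EFin // ltry.
(* To be applied to the positive and negative parts of [f]. *)
have cpos (g : T -> R) : (forall x, 0 <= g x <= `|f x|) ->
    cvgn (series (fun n => (v n)%:num * g n%:R)).
  move=> gf; apply: (series_le_cvg _ _ _ cf) => // n; have /andP[g0 g1] := gf n%:R.
  - exact: mulr_ge0.
  - by rewrite normrM (ger0_norm (x := (v n)%:num)) // ler_wpM2l.
have fp x : 0 <= Num.max (f x) 0 <= `|f x|.
  by rewrite le_max lexx orbT ge_max ler_norm normr_ge0.
have fn x : 0 <= Num.max (- f x) 0 <= `|f x|.
  by rewrite le_max lexx orbT ge_max -normrN ler_norm normr_ge0.
rewrite integralE.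
rewrite (eq_integral (fun x => (Num.max (f x) 0)%:E)); last first.
  by move=> x _; rewrite funeposE EFin_max.
rewrite [X in (_ - X)%E](eq_integral (fun x => (Num.max (- f x) 0)%:E)); last first.
  by move=> x _; rewrite funenegE EFin_max.
rewrite !(ge0_integral_atomic _ (f := fun x => Num.max _ 0)); first last.
- by move=> x; have /andP[] := fp x.
- exact: measurable_maxr.
- by move=> x; have /andP[] := fn x.
- by apply: measurable_maxr => //; exact: measurableT_comp.
rewrite !nneseries_EFin; [|exact: cpos fn|exact: cpos fp].
rewrite -EFinB; congr _%:E; apply/esym/cvg_lim => //.
have -> : series (fun n => (v n)%:num * f n%:R) =
    series (fun n => (v n)%:num * Num.max (f n%:R) 0) \-
    series (fun n => (v n)%:num * Num.max (- f n%:R) 0).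
  apply/funext => N; rewrite /series /= -sumrB; apply: eq_bigr => n _.
  rewrite -mulrBr; congr (_ * _).
  by rewrite /Order.max; do 2![case: ifPn]; rewrite -?leNgt; lra.
by apply: cvgB; [exact: cpos fp|exact: cpos fn].
Qed.

Section FiniteAtomic.
Variables (v : nat -> {nonneg R}) (vS : cvgn (series (fun n => (v n)%:num))).

(** Carrying the convergence proof in this alias allows a finite measure structure to be attached to
    it. *)
Definition finite_atomic of cvgn (series (fun n => (v n)%:num)) := atomic v.

HB.instance Definition _ := Measure.on (finite_atomic vS).

Let finite_atomic_fin : fin_num_fun (finite_atomic vS).
Proof.
apply: lty_fin_num_fun; change (atomic v setT < +oo)%E; rewrite atomicE.
under eq_eseriesr => n _ do rewrite in_setT mulr1.
by rewrite nneseries_EFin // ltry.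
Qed.

HB.instance Definition _ :=
  Measure_isFinite.Build _ _ _ (finite_atomic vS) finite_atomic_fin.

End FiniteAtomic.

Lemma cvg_partial_mass w (A : set T) (v : nat -> R) :
  (forall n, v n = w n * (n%:R \in A)%:R) -> cvgn (series v) ->
  (fun n => \sum_(0 <= x < n) (w x)%:E * \d_(x%:R : T) A)%E @ \oo -->
    (\sum_(n <oo) (v n)%:E)%E.
Proof.
move=> vE cv; rewrite nneseries_EFin //.
under eq_fun => n.
  under eq_bigr => x _ do rewrite diracE -EFinM -vE.
  rewrite sumEFin.
  over.
by apply: cvg_EFin => //; exact: nearW.
Qed.

Lemma series_restrict_cvg w (A : set T) : cvgn (series (fun n => `|w n|)) ->
  cvgn (series (fun n => w n * (n%:R \in A)%:R)).
Proof.
move=> cw; apply: normed_cvg; apply: (series_le_cvg _ _ _ cw) => //= n.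
by rewrite normrM ler_piMr // normr_nat; case: (_ \in _).
Qed.

Lemma discrete_charge_exists w : cvgn (series (fun n => `|w n|)) ->
  exists nu : {charge set T -> \bar R}, is_discrete_charge w nu.
Proof.
move=> cw.
(* [w] is the difference of the nonnegative summable weights [|w|] and [|w| - w], and each of them
   defines a finite measure. *)
have w0 n : 0 <= `|w n| - w n by rewrite subr_ge0 ler_norm.
pose v1 n : {nonneg R} := NngNum (normr_ge0 (w n)).
pose v2 n : {nonneg R} := NngNum (w0 n).
have c1 : cvgn (series (fun n => (v1 n)%:num)) by [].
have c2 : cvgn (series (fun n => (v2 n)%:num)).
  by apply: is_cvg_seriesB => //; exact: normed_cvg.
exists (cadd (charge_of_finite_measure (finite_atomic c1))
             (copp (charge_of_finite_measure (finite_atomic c2)))) => A mA.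
have cr v : cvgn (series (fun n => (v n)%:num)) ->
    cvgn (series (fun n => (v n)%:num * (n%:R \in A)%:R)).
  move=> cv; apply: series_restrict_cvg.
  by under eq_fun do rewrite ger0_norm //.
have nuA : (atomic v1 A - atomic v2 A = \sum_(n <oo) (w n * (n%:R \in A)%:R)%:E)%E.
  rewrite !atomicE !nneseries_EFin; [|exact: series_restrict_cvg|exact: cr|exact: cr].
  rewrite -EFinB; congr _%:E; apply/esym/cvg_lim => //.
  have -> : series (fun n => w n * (n%:R \in A)%:R) =
      series (fun n => (v1 n)%:num * (n%:R \in A)%:R) \-
      series (fun n => (v2 n)%:num * (n%:R \in A)%:R).
    apply/funext => N; rewrite /series /= -sumrB; apply: eq_bigr => n _.
    by rewrite -mulrBl subKr.
  by apply: cvgB; exact: cr.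
change ((fun n => \sum_(0 <= x < n) (w x)%:E * \d_(x%:R : T) A)%E @ \oo -->
  (atomic v1 A - atomic v2 A)%E).
by rewrite nuA; apply: cvg_partial_mass => //; exact: series_restrict_cvg.
Qed.

Section Integration.
Variables (w : nat -> R) (nu : {charge set T -> \bar R}).
Hypotheses (cw : cvgn (series (fun n => `|w n|))) (wnu : is_discrete_charge w nu).

Lemma discrete_chargeE (A : set T) : measurable A ->
  nu A = (limn (series (fun n => w n * (n%:R \in A)%:R)))%:E.
Proof.
move=> mA; rewrite -nneseries_EFin; last exact: series_restrict_cvg.
apply: (cvg_unique _ (wnu mA)) => //.
by apply: cvg_partial_mass => //; exact: series_restrict_cvg.
Qed.

Lemma discrete_charge1 n : nu [set (n%:R : T)] = (w n)%:E.
Proof.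
rewrite discrete_chargeE //; congr _%:E; apply/cvg_lim => //.
apply: cvg_near_cst; exists n.+1 => // N /= nN; rewrite /series /=.
have inn i : ((i%:R : T) \in [set (n%:R : T)]) = (i == n).
  by apply/idP/eqP => [|->]; rewrite inE //= => /eqP; rewrite eqr_nat => /eqP.
rewrite (bigD1_seq n) ?mem_index_iota ?iota_uniq //= inn.
rewrite eqxx mulr1 big1 ?addr0 // => i /negPf ni.
by rewrite inn ni mulr0.
Qed.

Lemma positive_discrete_chargeP :
  positive_charge nu <-> forall n, 0 <= w n.
Proof.
split => [[_ nu0] n|w0].
  by rewrite -lee_fin -discrete_charge1; apply: nu0.
split => // A mA _; rewrite discrete_chargeE // lee_fin.
apply: limr_ge; first exact: series_restrict_cvg.
by apply: nearW => N; rewrite /series /=; apply: sumr_ge0 => i _; exact: mulr_ge0.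
Qed.

Section Jordan.
Variables (P N : set T) (nuPN : hahn_decomposition nu P N).

Lemma hahn_mass_pos n : 0 <= w n * (n%:R \in P)%:R.
Proof.
have [[mP nuP] _ _ _] := nuPN; case: (boolP (n%:R \in P)); last by rewrite mulr0.
rewrite inE mulr1 -lee_fin -discrete_charge1 => nP; apply: nuP => //.
by move=> _ ->.
Qed.

Lemma hahn_mass_neg n : 0 <= - (w n * (n%:R \in N)%:R).
Proof.
have [_ [mN nuN] _ _] := nuPN; case: (boolP (n%:R \in N)); last by rewrite mulr0 oppr0.
rewrite inE mulr1 oppr_ge0 -lee_fin -discrete_charge1 => nN; apply: nuN => //.
by move=> _ ->.
Qed.

(** The positive part is [nu] restricted to [P], hence keeps exactly the atoms lying in [P]. *)
Lemma jordan_pos_atomic (A : set T) : measurable A ->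
  jordan_pos nuPN A = atomic (fun n => NngNum (hahn_mass_pos n)) A.
Proof.
move=> mA; have [[mP _] _ _ _] := nuPN.
rewrite jordan_posE charge.cjordan_posE /crestr0 mem_set // /crestr.
rewrite discrete_chargeE; last exact: measurableI.
rewrite atomicE nneseries_EFin /=.
  congr (limn (series _))%:E; apply/funext => n.
  by rewrite in_setI -mulrA -natrM mulnb andbC.
by apply: series_restrict_cvg; apply: (series_le_cvg _ _ _ cw) => // n;
  rewrite normrM ler_piMr // normr_nat; case: (_ \in _).
Qed.

Lemma jordan_neg_atomic (A : set T) : measurable A ->
  jordan_neg nuPN A = atomic (fun n => NngNum (hahn_mass_neg n)) A.
Proof.
move=> mA; have [_ [mN _] _ _] := nuPN.
rewrite jordan_negE charge.cjordan_negE /crestr0 mem_set // /crestr.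
rewrite discrete_chargeE; last exact: measurableI.
have c : cvgn (series (fun n => - (w n * (n%:R \in N)%:R) * (n%:R \in A)%:R)).
  by apply: series_restrict_cvg; apply: (series_le_cvg _ _ _ cw) => // n;
    rewrite normrN normrM ler_piMr // normr_nat; case: (_ \in _).
rewrite atomicE nneseries_EFin //=; congr _%:E.
apply/esym/cvg_lim => //.
have -> : (fun n => - (w n * (n%:R \in N)%:R) * (n%:R \in A)%:R) =
    \- (fun n => w n * (n%:R \in A `&` N)%:R).
  apply/funext => n /=.
  by rewrite in_setI mulNr -mulrA -natrM mulnb andbC.
have -> : series (\- (fun n => w n * (n%:R \in A `&` N)%:R)) =
    \- series (fun n => w n * (n%:R \in A `&` N)%:R).
  by apply/funext => M; rewrite /series /= sumrN.
by apply: cvgN; exact: series_restrict_cvg.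
Qed.

End Jordan.

Lemma discrete_charge_integral (f : T -> R) : measurable_fun [set: T] f ->
  cvgn (series (fun n => `|w n * f n%:R|)) ->
  charge_has_integral nu (fun x => (f x)%:E)
    (limn (series (fun n => w n * f n%:R)))%:E.
Proof.
move=> mf cf P N nuPN.
have [_ _ PNT PN0] := nuPN.
have cvg_restr (v : nat -> {nonneg R}) : (forall n, (v n)%:num <= `|w n|) ->
    cvgn (series (fun n => `|(v n)%:num * f n%:R|)).
  move=> vw; apply: (series_le_cvg _ _ _ cf) => // n.
  by rewrite !normrM ler_wpM2r // ger0_norm.
have wb (b : bool) n : `|w n * b%:R| <= `|w n|.
  by rewrite normrM ler_piMr // normr_nat; case: b.
have cP : cvgn (series (fun n => `|(NngNum (hahn_mass_pos nuPN n))%:num * f n%:R|)).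
  by apply: cvg_restr => n /=; apply: le_trans (ler_norm _) (wb _ _).
have cN : cvgn (series (fun n => `|(NngNum (hahn_mass_neg nuPN n))%:num * f n%:R|)).
  by apply: cvg_restr => n /=; apply: le_trans (ler_norm _) _; rewrite normrN.
have [iP intP] := integral_atomic mf cP.
have [iN intN] := integral_atomic mf cN.
split.
- apply/integrableP; case/integrableP: iP => mEf; split=> //.
  by rewrite (eq_measure_integral _ (fun A mA _ => jordan_pos_atomic nuPN mA)).
- apply/integrableP; case/integrableP: iN => mEf; split=> //.
  by rewrite (eq_measure_integral _ (fun A mA _ => jordan_neg_atomic nuPN mA)).
rewrite (eq_measure_integral _ (fun A mA _ => jordan_pos_atomic nuPN mA)).
rewrite (eq_measure_integral _ (fun A mA _ => jordan_neg_atomic nuPN mA)).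
rewrite intP intN -EFinB; congr _%:E; apply/esym/cvg_lim => //.
have -> : series (fun n => w n * f n%:R) =
    series (fun n => (NngNum (hahn_mass_pos nuPN n))%:num * f n%:R) \-
    series (fun n => (NngNum (hahn_mass_neg nuPN n))%:num * f n%:R).
  apply/funext => M; rewrite /series /= -sumrB; apply: eq_bigr => n _.
  rewrite -mulrBl opprK -mulrDr -natrD; congr (_ * _).
  (* Each natural number lies in exactly one of [P] and [N], so the two atomic masses subtract to
     [w n]. *)
  have : (n%:R : T) \in P `|` N by rewrite PNT in_setT.
  have : (n%:R : T) \notin P `&` N by rewrite PN0 in_set0.
  by rewrite in_setI in_setU; do 2![case: (_ \in _)] => //=; rewrite mulr1.
by apply: cvgB; exact: normed_cvg.
Qed.

End Integration.
End AtomicCharge.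

(** * Orthogonality *)

Section Casoratian.
Variables (R : realType) (a : R).
Implicit Types (k : nat) (t : seq nat) (F : {fset nat}).

Definition casoratian k t : {poly R} :=
  \det (\matrix_(i < k, j < k) shift_poly j (charlier a (nth 0%N t i))).

Lemma casoratianE k t y : (casoratian k t).[y] =
  \det (\matrix_(i < k, j < k) (charlier a (nth 0%N t i)).[y + j%:R]).
Proof.
rewrite -[LHS]/(horner_eval y _) -det_map_mx; congr (\det _).
by apply/matrixP => i j; rewrite !mxE; apply: shift_polyE.
Qed.

Lemma OmegaE F : Omega a F = casoratian #|` F| (elems F).
Proof. by []. Qed.

Lemma xcharlierE F n :
  xcharlier a F n = casoratian #|` F|.+1 ((n - uF F)%N :: elems F).
Proof. by []. Qed.

Lemma casoratian_telescope k m l t y :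
  (m%:R - l%:R) * ((casoratian k.+1 (m :: t)).[y] * (casoratian k.+1 (l :: t)).[y]) =
  a * (casoratian k.+2 (m :: l :: t)).[y] * (casoratian k t).[y] -
  y * (casoratian k.+2 (m :: l :: t)).[y - 1] * (casoratian k t).[y + 1].
Proof.
pose ix (i : 'I_k.+2) := nth 0%N (m :: l :: t) i.
(* Node [0] is [y - 1], so that the columns [j.+1] start at [y] and the boundary coefficient [b 0]
   is [y]. *)
pose g i j := (charlier a (ix i)).[y - 1 + j%:R].
have gS i j : g i j.+1 = (charlier a (ix i)).[y + j%:R].
  by rewrite /g -natr1; congr (_.[_]); ring.
have rec i j : (y + j%:R) * g i j + a * g i j.+2 =
    (y + j%:R + a - (ix i)%:R) * g i j.+1.
  rewrite !gS /g -charlier_eigen -natr1; congr (_ * _.[_] + a * _.[_]); ring.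
have := casorati_identity rec; rewrite /= addr0 => E.
rewrite !casoratianE; apply: (etrans _ (etrans E _)).
  congr (_ * _); congr (_ * _); congr (\det _); apply/matrixP => i j; rewrite !mxE gS.
    by case: (unliftP ord0 i) => [i'|] ->.
  by case: (unliftP ord0 i) => [i'|] ->.
congr (_ * _ * _ - _ * _ * _); congr (\det _).
all: apply/matrixP => i j; rewrite !mxE ?gS //.
by rewrite -natr1; congr (_.[_]); ring.
Qed.

End Casoratian.

Section Orthogonality.
Variables (R : realType) (a : R) (F : {fset nat}).
Hypothesis Omega_neq0 : forall n : nat, (Omega a F).[n%:R] != 0.
Local Notation k := #|` F|.
Local Notation t := (elems F).

Lemma exp_dominated_omega_mass : exp_dominated (omega_mass a F).
Proof.
have [K OK] := horner_inv_bound Omega_neq0.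
have -> : omega_mass a F = fun x => exp_coeff a x *
    ((Omega a F).[x%:R]^-1 * (Omega a F).[x.+1%:R]^-1).
  by apply/funext => x; rewrite /omega_mass /exp_coeff /= !invfM; ring.
apply: (exp_dominated_bounded (K := K * K)) (exp_dominated_exp_coeff a) => x.
by rewrite normrM; apply: ler_pM.
Qed.

Lemma xcharlier_orthogonal m l : m <> l ->
  limn (series (fun x => omega_mass a F x *
    ((casoratian a k.+1 (m :: t)).[x%:R] * (casoratian a k.+1 (l :: t)).[x%:R]))) = 0.
Proof.
move=> ml; set V := casoratian a k.+2 (m :: l :: t).
have ml0 : m%:R - l%:R != 0 :> R by rewrite subr_eq0 eqr_nat; apply/eqP.
(* [B] is a discrete primitive of the summand, up to [m - l]: the factor [x] gives [B 0 = 0], and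
   the exponential coefficient forces the limit [0]. *)
pose B (x : nat) := exp_coeff a x * (x%:R * V.[x%:R - 1]) * (Omega a F).[x%:R]^-1.
have B0 : B @ \oo --> 0.
  apply: exp_dominated_cvg0; have [K OK] := horner_inv_bound Omega_neq0.
  apply: (exp_dominated_bounded OK).
  have := exp_dominated_horner ('X * (V \Po ('X - 1%:P))) (exp_dominated_exp_coeff a).
  by under eq_fun do rewrite hornerM hornerX horner_comp hornerD hornerN hornerX hornerC.
have Bser N : series (fun x => omega_mass a F x *
    ((casoratian a k.+1 (m :: t)).[x%:R] * (casoratian a k.+1 (l :: t)).[x%:R])) N =
    (m%:R - l%:R)^-1 * B N.
  elim: N => [|N IH]; first by rewrite /series /= big_geq // /B mul0r mulr0 mul0r mulr0.
  rewrite seriesSr IH.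
  apply: (mulfI ml0); rewrite mulrDr !mulVKf // [X in _ + X]mulrCA casoratian_telescope.
  have ON := Omega_neq0 N; have ON1 := Omega_neq0 N.+1.
  rewrite -/V -!OmegaE /B /omega_mass /exp_coeff /= factS natrM -!natr1 addrK exprS.
  have fN := factr_neq0 R N.
  rewrite -natr1 in ON1; have N0 : N%:R + 1 != 0 :> R by rewrite natr1 pnatr_eq0.
  by field; rewrite fN ON ON1 N0.
rewrite (funext Bser); apply: cvg_lim => //.
by rewrite -[X in _ --> X](mulr0 (m%:R - l%:R)^-1); apply: cvgMl_tmp.
Qed.

Lemma discrete_charge_orthogonal (nu : {charge set (measurableTypeR R) -> \bar R}) :
  is_discrete_charge (omega_mass a F) nu ->
  orthogonal_family nu (sigmaF F) (xcharlier a F).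
Proof.
move=> wnu n m [un _] [um _] nm.
have cw := exp_dominated_series exp_dominated_omega_mass.
have nml : (n - uF F)%N <> (m - uF F)%N.
  by move=> e; apply: nm; rewrite -(subnK un) e subnK.
have mf : measurable_fun setT (fun x : measurableTypeR R =>
    (xcharlier a F n).[x] * (xcharlier a F m).[x]).
  by apply: measurable_funM; exact: measurable_poly.
have := discrete_charge_integral cw wnu mf.
rewrite !xcharlierE xcharlier_orthogonal //; apply; apply: exp_dominated_series.
have := exp_dominated_horner (xcharlier a F n * xcharlier a F m) exp_dominated_omega_mass.
by under eq_fun do rewrite hornerM.
Qed.

End Orthogonality.

(** * Admissible sets *)

Section Admissibility.
Implicit Types (F A B Y : {fset nat}).
Local Open Scope nat_scope.

Lemma perm_elems F : perm_eq (elems F) (enum_fset F).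
Proof. exact: permEl (perm_sort _ _). Qed.

Lemma mem_elems F : elems F =i F.
Proof. by move=> x; rewrite (perm_mem (perm_elems F)). Qed.

Lemma size_elems F : size (elems F) = #|` F|.
Proof. by rewrite (perm_size (perm_elems F)). Qed.

(** For [n] outside [F], its parity is the sign of the product of the [n - f]. *)
Definition count_above n F := count (ltn n) (enum_fset F).

Lemma count_fsetU P A B : [disjoint A & B]%fset ->
  count P (enum_fset (A `|` B)%fset) = count P (enum_fset A) + count P (enum_fset B).
Proof.
move=> /fdisjointP dAB; rewrite -count_cat; apply/permP/uniq_perm.
- exact: fset_uniq.
- rewrite cat_uniq !fset_uniq andbT /=; apply/hasPn => x /= xB.
  by apply: contraL xB; exact: dAB.
- by move=> x; rewrite mem_cat in_fsetU.
Qed.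

Lemma count_above_all n F : (forall f, f \in F -> n < f) -> count_above n F = #|` F|.
Proof. by move=> nF; apply/eqP; rewrite -all_count; apply/allP. Qed.

Lemma count_above_none n F : (forall f, f \in F -> f <= n) -> count_above n F = 0.
Proof.
move=> nF; apply/eqP; rewrite -leqn0 leqNgt -has_count -all_predC.
by apply/allP => f fF /=; rewrite -leqNgt; exact: nF.
Qed.

(** A block avoiding [n] lies entirely on one side of it, so it contributes all or none of its
    elements. *)
Lemma count_above_consecutive n Y : consecutive Y -> ~~ odd #|` Y| -> n \notin Y ->
  ~~ odd (count_above n Y).
Proof.
move=> [_ [m Ym]] oY nY.
have memY f : (f \in Y) = (m <= f < m + #|` Y|) by rewrite -mem_elems Ym mem_iota.
have [nm|mn] := ltnP n m.
  by rewrite count_above_all // => f; rewrite memY => /andP[mf _]; exact: leq_trans mf.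
rewrite count_above_none // => f; rewrite memY => /andP[_ fm].
by move: nY; rewrite memY mn -leqNgt; apply: leq_trans; exact: ltnW.
Qed.

Lemma admissible_count F : admissible F ->
  forall n, n \notin F -> ~~ odd (count_above n F).
Proof.
move=> [Ys [[-> dis cons _] even]] n.
elim: Ys dis cons even => [|Y Ys IH] /=; first by rewrite big_nil.
move=> /andP[/allP dY dis] cons even; rewrite big_cons in_fsetU negb_or => /andP[nY nYs].
have YYs : [disjoint Y & (\bigcup_(Z <- Ys) Z)%fset]%fset.
  apply/fdisjointP => x xY; apply/bigfcupP => -[Z /andP[ZYs _] xZ].
  by have /fdisjointP/(_ x xY) := dY _ ZYs; rewrite xZ.
rewrite /count_above count_fsetU // oddD negb_add.
rewrite (negPf (IH _ _ _ nYs)) //.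
- rewrite (negPf (count_above_consecutive _ _ nY)) //.
    by apply: cons; rewrite mem_head.
  by apply: even; rewrite mem_head.
- by move=> Z ZYs; apply: cons; rewrite inE ZYs orbT.
- by move=> Z ZYs; apply: even; rewrite inE ZYs orbT.
Qed.

Lemma elems_iota m c : elems [fset x | x in iota m c]%fset = iota m c.
Proof.
apply: (sorted_eq leq_trans anti_leq).
- exact: (sort_sorted leq_total).
- exact: iota_sorted.
- apply: uniq_perm; rewrite ?sort_uniq ?fset_uniq ?iota_uniq // => x.
  by rewrite mem_elems inE.
Qed.

(** Peel off the lowest maximal block [[m, M)]. The count at the gap [M] is the size of the rest;
    the count at [0], a gap by positivity, is the size of [F]. Both are even, hence so is the
    block. *)
Lemma count_admissible F : (forall f, f \in F -> 0 < f) ->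
  (forall n, n \notin F -> ~~ odd (count_above n F)) -> admissible F.
Proof.
move: {2}#|` F|.+1 (ltnSn #|` F|) => c; elim: c F => // c IH F Fc F0 Fe.
have [->|[x0 x0F]] := fset_0Vmem F.
  by exists [::]; split=> //; split; rewrite ?big_nil.
have exm : exists x, x \in F by exists x0.
case: (ex_minnP exm) => m mF mmin {exm x0 x0F}.
have exM : exists x, (m < x) && (x \notin F).
  (* One more than the sum of the elements exceeds each of them. *)
  exists (\sum_(f <- enum_fset F) f).+1.
  have leS f : f \in F -> f <= \sum_(f <- enum_fset F) f.
    by move=> fF; rewrite (big_rem f) //= leq_addr.
  by rewrite ltnS leS //=; apply/negP => /leS; rewrite ltnn.
case: (ex_minnP exM) => M /andP[mM MF] Mmin {exM}.
pose Y := [fset x | x in iota m (M - m)]%fset.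
have memY x : (x \in Y) = (m <= x < M) by rewrite !inE /= mem_iota subnKC // ltnW.
have elY : elems Y = iota m (M - m) by exact: elems_iota.
have cY : #|` Y| = M - m by rewrite -size_elems elY size_iota.
have YF x : x \in Y -> x \in F.
  rewrite memY => /andP[]; rewrite leq_eqVlt => /orP[/eqP <- //|mx xM].
  by apply: contraLR xM => xF; rewrite -leqNgt Mmin // mx.
pose F' := (F `\` Y)%fset.
have F'F x : x \in F' -> x \in F by rewrite in_fsetD => /andP[].
have F'M x : x \in F' -> M < x.
  rewrite in_fsetD memY => /andP[xY xF]; move: xY.
  rewrite mmin //= -leqNgt leq_eqVlt => /orP[/eqP Mx|//].
  by rewrite -Mx (negPf MF) in xF.
have dYF' : [disjoint Y & F']%fset by apply/fdisjointP => x xY; rewrite in_fsetD xY.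
have FE : F = (Y `|` F')%fset.
  by apply/fsetP => x; rewrite in_fsetU in_fsetD; case: (boolP (x \in Y)) => //= /YF.
have countF n : count_above n F = count_above n Y + count_above n F'.
  by rewrite {1}FE; exact: count_fsetU.
have eF' : ~~ odd #|` F'|.
  have := Fe M MF; rewrite countF count_above_none ?add0n; last first.
    by move=> f; rewrite memY => /andP[_ /ltnW].
  by rewrite count_above_all.
have eY : ~~ odd #|` Y|.
  have := Fe 0; rewrite countF !count_above_all; first last.
  - by move=> f /YF/F0.
  - by move=> f /F'F/F0.
  rewrite oddD (negPf eF') addbF; apply.
  by apply/negP => /F0; rewrite ltnn.
have [||Ys [[F'E dis cons srt] even]] := IH F' _ (fun f fF' => F0 f (F'F f fF')).
- rewrite -ltnS; apply: leq_trans Fc; rewrite ltnS.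
  have := cardfsUI Y F'; rewrite -FE (disjoint_fsetI0 dYF').
  rewrite cardfs0 addn0 => ->.
  by rewrite cY -[X in X < _]add0n ltn_add2r subn_gt0.
(* Below [M] all of [F'] is counted and [eF'] applies; from [M] on the block [Y] counts for nothing
   and the hypothesis on [F] applies. *)
- move=> n nF'; have [nM|Mn] := ltnP n M.
    by rewrite count_above_all // => f /F'M; exact: ltn_trans.
  have nF : n \notin F by rewrite FE in_fsetU negb_or nF' memY andbT negb_and -!leqNgt Mn orbT.
  have := Fe n nF; rewrite countF count_above_none // => f.
  by rewrite memY => /andP[_ /ltnW fM]; exact: leq_trans Mn.
have ZF' Z x : Z \in Ys -> x \in Z -> x \in F'.
  by move=> ZYs xZ; rewrite F'E; apply/bigfcupP; exists Z; rewrite ?ZYs.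
exists (Y :: Ys); split; last by move=> Z; rewrite inE => /orP[/eqP -> //|]; exact: even.
split.
- by rewrite big_cons -F'E.
- rewrite /= dis andbT; apply/allP => Z ZYs; apply/fdisjointP => x xY.
  apply/negP => xZ; have := ZF' _ _ ZYs xZ; by rewrite in_fsetD xY.
- move=> Z; rewrite inE => /orP[/eqP ->|]; last exact: cons.
  split; last by exists m; rewrite elY cY.
  by apply/fset0Pn; exists m; rewrite memY leqnn.
- case: Ys {F'E dis even} srt cons ZF' => //= Z Ys srt cons ZF'; rewrite srt andbT.
  have [Z0 _] := cons Z (mem_head _ _).
  have sZ : 0 < size (elems Z) by rewrite size_elems cardfs_gt0.
  have hF' : head 0 (elems Z) \in F'.
    apply: (ZF' Z); first by rewrite mem_head.
    by rewrite -mem_elems; case: (elems Z) sZ => //= h s _; rewrite mem_head.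
  (* The last element of [Y] is [M - 1], so the required gap amounts to [M] being below the next
     block. *)
  apply: leq_ltn_trans (F'M _ hF'); rewrite elY.
  have -> : M - m = (M - m).-1.+1 by rewrite prednK // subn_gt0.
  rewrite -nth_last size_iota nth_iota //=; lia.
Qed.

Lemma admissibleP F : (forall f, f \in F -> 0 < f) ->
  (admissible F <-> forall n, n \notin F -> ~~ odd (count_above n F)).
Proof.
by move=> F0; split; [exact: admissible_count|exact: count_admissible].
Qed.

(** Each [f] above [n] contributes one negative factor; at points of [F] the product is [0]. *)
Lemma prod_subr_ge0P (R : realDomainType) F :
  (forall n : nat, (0 <= \prod_(f <- elems F) (n%:R - f%:R : R))%R) <->
  (forall n, n \notin F -> ~~ odd (count_above n F)).
Proof.
have sgE n (s : seq nat) : n \notin s ->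
    (0 < (-1) ^+ count (ltn n) s * \prod_(f <- s) (n%:R - f%:R : R))%R.
  elim: s => [|f s IH]; first by rewrite big_nil mulr1.
  rewrite inE negb_or big_cons /= => /andP[nf /IH {}IH].
  rewrite exprD mulrACA pmulr_lgt0 //.
  have [lt|ge] := ltnP n f; first by rewrite expr1 mulN1r opprB subr_gt0 ltr_nat.
  by rewrite expr0 mul1r subr_gt0 ltr_nat ltn_neqAle eq_sym nf.
have cE n : count (ltn n) (elems F) = count_above n F.
  exact/permP/perm_elems.
split => H n.
  move=> nF; have := sgE n (elems F); rewrite mem_elems cE => /(_ nF).
  rewrite -signr_odd; case: odd => //.
  by rewrite expr1 mulN1r oppr_gt0 ltNge H.
have [nF|nF] := boolP (n \in F).
  by rewrite (big_rem n) ?mem_elems //= subrr mul0r.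
have := sgE n (elems F); rewrite mem_elems cE => /(_ nF).
by rewrite -signr_odd (negPf (H n nF)) expr0 mul1r => /ltW.
Qed.

End Admissibility.

(** * Positivity *)

Section PoissonFunctional.
Variables (R : realType) (a : R).
Implicit Types (p q r : {poly R}) (n : nat).

(** For [a > 0] this is [e ^ a] times the expectation under the Poisson law of mean [a]. *)
Definition poisson p : R := limn (series (fun n => exp_coeff a n * p.[n%:R])).

Lemma poisson_cvg p :
  series (fun n => exp_coeff a n * p.[n%:R]) @ \oo --> poisson p.
Proof.
exact: exp_dominated_cvg (exp_dominated_horner p (exp_dominated_exp_coeff a)).
Qed.

Lemma eq_poisson p q : (forall n, p.[n%:R] = q.[n%:R]) -> poisson p = poisson q.
Proof.
move=> pq; rewrite /poisson; congr (limn (series _)); apply/funext => n.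
by rewrite pq.
Qed.

Lemma poisson_linear c p q : poisson (c *: p + q) = c * poisson p + poisson q.
Proof.
apply: cvg_lim => //.
have -> : series (fun n => exp_coeff a n * (c *: p + q).[n%:R]) =
    (fun N => c * series (fun n => exp_coeff a n * p.[n%:R]) N) \+
    series (fun n => exp_coeff a n * q.[n%:R]).
  apply/funext => N /=; rewrite /series /= mulr_sumr -big_split /=.
  by apply: eq_bigr => n _; rewrite hornerD hornerZ; ring.
by apply: cvgD; [apply: cvgMl_tmp|]; exact: poisson_cvg.
Qed.

Lemma poisson0 : poisson 0 = 0.
Proof. by have := poisson_linear (-1) 0 0; rewrite scaler0 addr0 mulN1r addNr. Qed.

Lemma poissonD p q : poisson (p + q) = poisson p + poisson q.
Proof. by rewrite -[p]scale1r poisson_linear mul1r scale1r. Qed.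

Lemma poissonZ c p : poisson (c *: p) = c * poisson p.
Proof. by rewrite -[c *: p]addr0 poisson_linear poisson0 addr0. Qed.

Lemma poisson_sum n (f : 'I_n -> {poly R}) :
  poisson (\sum_i f i) = \sum_i poisson (f i).
Proof. exact: (big_morph _ poissonD poisson0). Qed.

(** Index shift: [n] times the weight at [n] is [a] times the weight at [n - 1], and the term at [0]
    vanishes. *)
Lemma poisson_mulX p : poisson ('X * p) = a * poisson (shift_poly 1 p).
Proof.
have c1 := @poisson_cvg ('X * p); rewrite -cvg_shiftS in c1.
apply: (cvg_unique _ c1) => //.
have -> : [sequence series (fun n => exp_coeff a n * ('X * p).[n%:R]) n.+1]_n =
    fun N => a * series (fun n => exp_coeff a n * (shift_poly 1 p).[n%:R]) N.
  apply/funext => N; rewrite /series /= big_nat_recl //= hornerM hornerX.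
  rewrite mul0r mulr0 add0r mulr_sumr; apply: eq_bigr => n _.
  rewrite shift_polyE natr1 hornerM hornerX /exp_coeff /= factS natrM exprS.
  by rewrite -natr1; field; rewrite factr_neq0 natr1 pnatr_eq0.
by apply: cvgMl_tmp; exact: poisson_cvg.
Qed.

(** Summation by parts: for this functional the raising operator is adjoint to [a] times the forward
    difference. *)
Lemma poisson_charlierS n p :
  n.+1%:R * poisson (charlier a n.+1 * p) =
  a * poisson (charlier a n * (shift_poly 1 p - p)).
Proof.
rewrite -poissonZ.
rewrite (@eq_poisson _ ('X * ((charlier a n \Po ('X - 1%:P)) * p) +
    (- a) *: (charlier a n * p))); last first.
  move=> m; have := charlier_raise a n m%:R.
  move: (charlier a n) (charlier a n.+1) => c c' cc'.
  rewrite !(hornerD, hornerM, hornerZ, horner_comp, hornerX, hornerN, hornerC).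
  by rewrite [LHS]mulrA -cc'; ring.
rewrite poissonD poissonZ poisson_mulX.
rewrite (@eq_poisson _ (charlier a n * shift_poly 1 p)); last first.
  move=> m; rewrite hornerM !shift_polyE; move: (charlier a n) => c.
  by rewrite !(hornerD, hornerM, horner_comp, hornerX, hornerN, hornerC) addrK.
rewrite mulrBr -[in RHS](scaleN1r (charlier a n * p)) poissonD poissonZ; ring.
Qed.

Lemma size_shift_diff p : (size (shift_poly 1 p - p)%R <= (size p).-1)%N.
Proof.
have s2 : size ('X + (1%:R)%:P : {poly R}) = 2%N by rewrite size_XaddC.
have sp : size (shift_poly 1 p) = size p by rewrite /shift_poly size_comp_poly2.
apply/leq_sizeP => j; rewrite leq_eqVlt => /orP[/eqP <-|pj].
  rewrite coefB -{1}sp -!lead_coefE /shift_poly lead_coef_comp ?s2 //.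
  by rewrite lead_coefXaddC expr1n mulr1 subrr.
have jp : (size p <= j)%N by case: (size p) pj.
by rewrite coefB !nth_default ?subrr // sp.
Qed.

(** Each summation by parts lowers the degree of [p], so [n] of them reduce [p] to [0]. *)
Lemma poisson_charlier_orthogonal n p : (size p <= n)%N ->
  poisson (charlier a n * p) = 0.
Proof.
elim: n p => [|n IH] p sp.
  by move: sp; rewrite leqn0 size_poly_eq0 => /eqP ->; rewrite mulr0 poisson0.
have n0 : n.+1%:R != 0 :> R by rewrite pnatr_eq0.
apply: (mulfI n0); rewrite poisson_charlierS mulr0 IH ?mulr0 //.
by apply: leq_trans (size_shift_diff _) _; rewrite -ltnS; case: (size p) sp.
Qed.

Hypothesis a_gt0 : 0 < a.

Lemma exp_coeff_gt0 n : 0 < exp_coeff a n.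
Proof. by rewrite /exp_coeff /= divr_gt0 ?exprn_gt0 // ltr0n fact_gt0. Qed.

(** Keeping the term at [0] as lower bound gives strict positivity whenever [p] is positive
    there. *)
Lemma poisson_ge0 p : (forall n, 0 <= p.[n%:R]) -> exp_coeff a 0 * p.[0] <= poisson p.
Proof.
move=> p0; apply: limr_ge; first exact: poisson_cvg.
exists 1%N => // N /= N1; rewrite /series /= -(subnKC N1) big_nat_recl //=.
rewrite lerDl; apply: sumr_ge0 => i _.
by rewrite mulr_ge0 // ltW // exp_coeff_gt0.
Qed.

End PoissonFunctional.

Lemma size_sub_lead (R : nzRingType) (p q : {poly R}) n :
  size p = n.+1 -> size q = n.+1 -> lead_coef p = lead_coef q ->
  (size (p - q)%R <= n)%N.
Proof.
move=> sp sq; rewrite !lead_coefE sp sq /= => pq.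
apply/leq_sizeP => j; rewrite leq_eqVlt coefB => /orP[/eqP <-|nj].
  by rewrite pq subrr.
by rewrite !nth_default ?subrr ?sp ?sq.
Qed.

(** * The Christoffel transform of the Poisson weight *)

Section Christoffel.
Variables (R : realType) (a : R) (F : {fset nat}).
Hypothesis a_gt0 : 0 < a.
Hypothesis Omega_neq0 : forall n : nat, (Omega a F).[n%:R] != 0.
Local Notation k := #|` F|.
Local Notation t := (elems F).
Local Notation P := (dual_charlier a).

Let a_neq0 : a != 0. Proof. exact: lt0r_neq0. Qed.

Definition annihilator : {poly R} := \prod_(f <- t) ('X - (f%:R)%:P).

Lemma annihilatorE y : annihilator.[y] = \prod_(f <- t) (y - f%:R).
Proof.
by rewrite /annihilator horner_prod; apply: eq_bigr => f _; rewrite hornerXsubC.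
Qed.

Lemma poisson_dual_orthogonal n (p : {poly R}) : (size p <= n)%N -> poisson a (P n * p) = 0.
Proof.
by move=> sp; rewrite -scalerAl poissonZ poisson_charlier_orthogonal ?mulr0.
Qed.

Lemma poisson_dual_norm_gt0 n : 0 < poisson a (P n * P n).
Proof.
apply: lt_le_trans (poisson_ge0 a_gt0 _).
  (* By duality [P n] at [0] equals [P 0] at [n], which is [1]. *)
  rewrite mulr_gt0 ?exp_coeff_gt0 // hornerM -[0]/(0%:R) dual_charlierC //.
  by rewrite hornerZ charlier0 fact0 expr0 divr1 !mulr1.
by move=> m; rewrite hornerM -expr2 sqr_ge0.
Qed.

Definition dual_det x : R :=
  \det (\matrix_(i < k, j < k) (P (x + j)%N).[(nth 0%N t i)%:R]).

Definition dual_scale : R := \prod_(i < k) ((nth 0%N t i)`!%:R / (- a) ^+ nth 0%N t i).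

Lemma dual_scale_neq0 : dual_scale != 0.
Proof.
apply/prodf_neq0 => i _.
by rewrite mulf_neq0 ?invr_eq0 ?factr_neq0 ?expNa_neq0.
Qed.

(** Duality exchanges degree and point entrywise; the normalising factors depend only on the row and
    come out as a diagonal matrix. *)
Lemma dual_detE x : dual_det x = dual_scale * (Omega a F).[x%:R].
Proof.
rewrite OmegaE casoratianE /dual_scale.
pose d (i : 'I_k) : R := (nth 0%N t i)`!%:R / (- a) ^+ nth 0%N t i.
have -> : \prod_(i < k) ((nth 0%N t i)`!%:R / (- a) ^+ nth 0%N t i) =
    \det (diag_mx (\row_i d i)).
  by rewrite det_diag; apply: eq_bigr => i _; rewrite mxE.
rewrite -det_mulmx; congr (\det _); apply/matrixP => i j.
rewrite mul_diag_mx !mxE dual_charlierC // natrD hornerZ //.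
Qed.

Definition christoffel_cofactor x (j : 'I_k.+1) : R :=
  (-1) ^+ j * \det (\matrix_(i < k, j' < k) (P (x + lift j j')%N).[(nth 0%N t i)%:R]).

(** The first-row expansion of the determinant whose first row is [P (x + j)] as polynomials and
    whose other rows are their values at the elements of [F]. *)
Definition christoffel x : {poly R} :=
  \sum_(j < k.+1) christoffel_cofactor x j *: P (x + j)%N.

Lemma christoffel_cofactor0 x : christoffel_cofactor x ord0 = dual_det x.+1.
Proof.
rewrite /christoffel_cofactor mul1r; congr (\det _); apply/matrixP => i j.
by rewrite !mxE /= /bump leq0n add1n addnS.
Qed.

Lemma christoffel_cofactor_max x :
  christoffel_cofactor x ord_max = (-1) ^+ k * dual_det x.
Proof.
rewrite /christoffel_cofactor; congr (_ * \det _); apply/matrixP => i j.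
by rewrite !mxE /= /bump leqNgt ltn_ord.
Qed.

(** At an element of [F] the first row of the determinant repeats another row. *)
Lemma christoffel_root x f : f \in t -> (christoffel x).[f%:R] = 0.
Proof.
move=> ft; have fk : (index f t < k)%N by rewrite -size_elems index_mem.
pose M := \matrix_(i < k.+1, j < k.+1)
  (P (x + j)%N).[(oapp (fun i' : 'I_k => nth 0%N t i') f (unlift ord0 i))%:R].
have <- : \det M = 0.
  apply: (@determinant_alternate _ _ _ ord0 (lift ord0 (Ordinal fk))) => // j.
  by rewrite !mxE unlift_none liftK /= nth_index.
rewrite /christoffel horner_sum (expand_det_row _ ord0); apply: eq_bigr => j _.
rewrite hornerZ mxE unlift_none mulrC /cofactor add0n; congr (_ * (_ * \det _)).
by apply/matrixP => i j'; rewrite !mxE liftK.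
Qed.

(** Only the last column reaches degree [x + k], and its cofactor is nonzero because [Omega] does
    not vanish at [x]. *)
Lemma christoffel_size_lead x : size (christoffel x) = (x + k).+1 /\
  lead_coef (christoffel x) = (-1) ^+ k * dual_det x / (- a) ^+ (x + k).
Proof.
have D0 : (-1) ^+ k * dual_det x != 0.
  by rewrite mulf_neq0 ?signr_eq0 // dual_detE mulf_neq0 ?dual_scale_neq0.
rewrite /christoffel big_ord_recr christoffel_cofactor_max /= addrC.
set p := _ *: _; set q := \sum_(_ < _) _.
have sp : size p = (x + k).+1 by rewrite size_scale // size_dual_charlier.
have qp : (size q < size p)%N.
  rewrite sp ltnS; apply: (leq_trans (size_sum _ _ _)); apply/bigmax_leqP => i _.
  apply: (leq_trans (size_scale_leq _ _)).
  by rewrite size_dual_charlier // -addnS leq_add2l.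
by rewrite size_polyDl // lead_coefDl // lead_coefZ lead_coef_dual_charlier.
Qed.

(* The Christoffel formula: [christoffel x] is orthogonal to lower degrees for
   the Poisson weight and is divisible by [annihilator], so the quotient is
   orthogonal for the Poisson weight multiplied by [annihilator]. *)
Lemma christoffel_quotient x : exists q : {poly R},
  [/\ size q = x.+1,
      forall r : {poly R}, (size r <= x)%N -> poisson a (annihilator * q * r) = 0 &
      exists2 h, 0 < h &
        poisson a (annihilator * q * q) =
          h * ((Omega a F).[x%:R] * (Omega a F).[x.+1%:R])].
Proof.
pose rs : seq R := [seq f%:R | f <- t].
have rsE : \prod_(z <- rs) ('X - z%:P) = annihilator by rewrite big_map.
have uS : uniq_roots rs.
  rewrite uniq_rootsE map_inj_uniq ?sort_uniq ?fset_uniq // => m n /eqP.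
  by rewrite eqr_nat => /eqP.
have rS : all (root (christoffel x)) rs.
  by apply/allP => _ /mapP[f ft ->]; apply/eqP; exact: christoffel_root.
have [q Wq] := uniq_roots_prod_XsubC rS uS; rewrite rsE in Wq.
have mA : annihilator \is monic by exact: monic_prod_XsubC.
have [sW lW] := christoffel_size_lead x.
have q0 : q != 0 by apply/eqP => q0; move: sW; rewrite Wq q0 mul0r size_poly0.
have sq : size q = x.+1.
  move: sW; rewrite Wq size_Mmonic // size_prod_XsubC size_elems addnS /=.
  by rewrite -addSn => /addIn.
have lq : lead_coef q = (-1) ^+ k * dual_det x / (- a) ^+ (x + k).
  by rewrite -lW Wq lead_coef_Mmonic.
have WE r : poisson a (annihilator * q * r) =
    \sum_(j < k.+1) christoffel_cofactor x j * poisson a (P (x + j)%N * r).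
  rewrite [annihilator * q]mulrC -Wq /christoffel mulr_suml poisson_sum.
  by apply: eq_bigr => j _; rewrite -scalerAl poissonZ.
exists q; split => // [r sr|].
  rewrite WE big1 // => j _; rewrite poisson_dual_orthogonal ?mulr0 //.
  exact: leq_trans (leq_addr _ _).
exists (dual_scale ^+ 2 * a ^- k * poisson a (P x * P x)).
  apply: mulr_gt0 (poisson_dual_norm_gt0 _); apply: mulr_gt0.
    by rewrite lt0r sqr_ge0 sqrf_eq0 dual_scale_neq0.
  by rewrite invr_gt0 exprn_gt0.
(* As [q] has degree [x], only the term [j = 0] survives. *)
rewrite WE big_ord_recl big1 ?addr0 => [|j _]; last first.
  rewrite poisson_dual_orthogonal ?mulr0 // sq /= /bump leq0n add1n addnS ltnS.
  exact: leq_addr.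
rewrite christoffel_cofactor0 /= addn0.
(* [b] is the ratio of the leading coefficients of [q] and [P x]; the signs [(-1) ^ k] cancel. *)
pose b := dual_det x / a ^+ k.
have b0 : b != 0.
  by rewrite /b mulf_neq0 ?invr_eq0 ?expf_neq0 // dual_detE mulf_neq0 ?dual_scale_neq0.
have sr : (size (q - b *: P x)%R <= x)%N.
  apply: size_sub_lead => //; first by rewrite size_scale // size_dual_charlier.
  rewrite lq lead_coefZ lead_coef_dual_charlier // exprD /b.
  rewrite (exprNn a k).
  have ax := expNa_neq0 a_neq0 x; have ak : a ^+ k != 0 by rewrite expf_neq0.
  have sk : (-1) ^+ k != 0 :> R by rewrite signr_eq0.
  by field; rewrite ax ak sk.
have -> : poisson a (P x * q) = b * poisson a (P x * P x).
  rewrite -[q in LHS](subrK (b *: P x)) mulrDr poissonD poisson_dual_orthogonal //.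
  by rewrite add0r -scalerAr poissonZ.
by rewrite /b !dual_detE; field; rewrite expf_neq0.
Qed.

(** Up to a positive factor the product is the squared norm of the quotient of degree [n]. *)
Lemma annihilator_sq_ge0 : (forall n : nat, 0 <= annihilator.[n%:R]) ->
  forall n : nat, 0 <= (Omega a F).[n%:R] * (Omega a F).[n.+1%:R].
Proof.
move=> A0 n; have [q [_ _ [h h0 qh]]] := christoffel_quotient n.
rewrite -(pmulr_rge0 _ h0) -qh.
have pos m : 0 <= (annihilator * q * q).[m%:R].
  by rewrite -mulrA !hornerM mulr_ge0 // -expr2 sqr_ge0.
apply: le_trans (poisson_ge0 a_gt0 pos).
by rewrite mulr_ge0 ?(pos 0%N) // ltW ?exp_coeff_gt0.
Qed.

(** Induction on the degree: cancelling the leading term of [p] by a multiple of the orthogonal [q]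
    of equal degree leaves no cross term, so the squared norms add. *)
Lemma poisson_annihilator_ge0 :
  (forall n : nat, 0 <= (Omega a F).[n%:R] * (Omega a F).[n.+1%:R]) ->
  forall p, 0 <= poisson a (annihilator * p * p).
Proof.
move=> O0 p; have [n] := ubnP (size p); elim: n p => // n IH p.
have [->|p0] := eqVneq p 0; first by rewrite mulr0 poisson0.
rewrite ltnS => sp; have [x sx] : exists x, size p = x.+1.
  by exists (size p).-1; rewrite prednK // lt0n size_poly_eq0.
have [q [sq qorth [h h0 qh]]] := christoffel_quotient x.
have q0 : lead_coef q != 0 by rewrite lead_coef_eq0 -size_poly_eq0 sq.
pose b := lead_coef p / lead_coef q; pose r := p - b *: q.
have b0 : b != 0 by rewrite mulf_neq0 ?invr_eq0 // lead_coef_eq0.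
have sr : (size r <= x)%N.
  by apply: size_sub_lead; rewrite ?size_scale ?lead_coefZ ?divfK.
have -> : p = b *: q + r by rewrite addrC subrK.
have -> : annihilator * (b *: q + r) * (b *: q + r) =
    b ^+ 2 *: (annihilator * q * q) +
    ((2 * b) *: (annihilator * q * r) + annihilator * r * r).
  rewrite -!mul_polyC !polyCM; ring.
rewrite !poissonD !poissonZ (qorth r) // mulr0 add0r qh addr_ge0 //.
  by rewrite mulr_ge0 ?sqr_ge0 // mulr_ge0 // ltW.
by apply: IH; apply: leq_ltn_trans sr _; rewrite -sx.
Qed.

End Christoffel.

(** * Recovering point values from the quadratic form *)

Section PointEvaluation.
Variable R : realType.

Lemma bin_le_exp2 n j : ('C(n, j) <= 2 ^ n)%N.
Proof.
elim: n j => [|n IH] [|j]; rewrite ?bin0 ?bin0n ?expn_gt0 //.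
by rewrite binS expnS mul2n -addnn leq_add.
Qed.

(* On the naturals, [point_poly c m] is [(-1)^m] at [c], vanishes at the other
   [n <= c + m], and is ['C(n, c) * 'C(n - c.+1, m)] beyond. *)
Definition point_poly c m : {poly R} :=
  bin_poly R c * (bin_poly R m \Po ('X - (c.+1%:R)%:P)).

Lemma point_polyE c m y :
  (point_poly c m).[y] = (bin_poly R c).[y] * (bin_poly R m).[y - c.+1%:R].
Proof. by rewrite hornerM horner_comp hornerXsubC. Qed.

Lemma bin_poly_N1 m : (bin_poly R m).[-1] = (-1) ^+ m.
Proof.
elim: m => [|m IH]; first by rewrite bin_poly0.
have := bin_poly_diff m (-1 : R); rewrite addNr IH.
have -> : (bin_poly R m.+1).[0] = 0 by rewrite -[0]/(0%:R) bin_poly_nat bin0n.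
by rewrite add0r exprS mulN1r => <-; rewrite opprK.
Qed.

Lemma point_poly_center c m : (point_poly c m).[c%:R] = (-1) ^+ m.
Proof.
by rewrite point_polyE bin_poly_nat binn mul1r -natr1 opprD addrA subrr add0r bin_poly_N1.
Qed.

Lemma point_poly_eq0 c m n : n != c -> (n <= c + m)%N -> (point_poly c m).[n%:R] = 0.
Proof.
move=> nc ncm; rewrite point_polyE; have [lt|ge] := ltnP n c.
  by rewrite bin_poly_nat bin_small ?mul0r.
have cn : (c.+1 <= n)%N by rewrite ltn_neqAle eq_sym nc.
rewrite -natrB // [X in _ * X]bin_poly_nat bin_small ?mulr0 //.
by rewrite ltn_subLR // addSn ltnS.
Qed.

Lemma point_poly_bound c m n : (c + m < n)%N -> `|(point_poly c m).[n%:R]| <= 4 ^+ n.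
Proof.
move=> ncm; have cn : (c < n)%N by apply: leq_ltn_trans ncm; exact: leq_addr.
rewrite point_polyE -natrB // !bin_poly_nat -natrM normr_nat -natrX ler_nat.
rewrite -[4%N]/(2 * 2)%N expnMn leq_mul ?bin_le_exp2 //.
by apply: leq_trans (bin_le_exp2 _ _) _; rewrite leq_exp2l // leq_subr.
Qed.

(** The squares of [point_poly c m] act as indicators of [c]: as [m] grows, the functional tends to
    the single term at [c]. *)
Lemma poisson_sq_ge0_nat (a : R) (p : {poly R}) : 0 < a ->
  (forall q : {poly R}, 0 <= poisson a (p * q * q)) -> forall c : nat, 0 <= p.[c%:R].
Proof.
move=> a0 pq c; rewrite leNgt; apply/negP => pc.
(* [16 ^ n] is the square of the bound [4 ^ n] on [point_poly]. *)
pose u n := `|exp_coeff a n * p.[n%:R] * 16 ^+ n|.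
have cu : cvgn (series u).
  apply: exp_dominated_series.
  apply: (exp_dominated_geometric (K := 1) (E := 16)) => [//|n|].
    by rewrite mul1r ger0_norm // exprn_ge0.
  exact/exp_dominated_horner/exp_dominated_exp_coeff.
have u0 n : 0 <= u n by rewrite /u.
set w := exp_coeff a c * p.[c%:R].
have w0 : w < 0 by rewrite /w pmulr_rlt0 // exp_coeff_gt0.
(* Testing with [point_poly c m] leaves the term [w] at [c], nothing else up to [c + m], and beyond
   that at most the tail of [u]. *)
have tail m : 0 <= w + (limn (series u) - series u (c + m).+1).
  apply: le_trans (pq (point_poly c m)) _; apply: limr_le.
    exact: (@poisson_cvg _ a).
  exists (c + m).+1 => // N /= cmN.
  pose f n := exp_coeff a n * (p * point_poly c m * point_poly c m).[n%:R].
  have fE n : f n = exp_coeff a n * p.[n%:R] * (point_poly c m).[n%:R] ^+ 2.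
    by rewrite /f !hornerM; ring.
  have uN : series u N <= limn (series u).
    by apply: nondecreasing_cvgn_le => //; apply: nondecreasing_series => n _ _.
  apply: (@le_trans _ _ (w + (series u N - series u (c + m).+1))); last first.
    by rewrite lerD2l lerD2r.
  change (series f N <= w + (series u N - series u (c + m).+1)); elim: N cmN {uN} => // N IH.
  rewrite leq_eqVlt => /orP[/eqP [<-]|cmN].
    rewrite subrr addr0 /series /= (bigD1_seq c) ?iota_uniq ?mem_index_iota //=; last first.
      by rewrite ltnS leq_addr.
    rewrite big_seq_cond big1 ?addr0.
      by rewrite fE point_poly_center sqrr_sign mulr1.
    move=> i /andP[]; rewrite mem_index_iota /= => icm ic.
    by rewrite fE point_poly_eq0 // expr0n mulr0.
  rewrite [series f _]seriesSr [series u N.+1]seriesSr.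
  apply: le_trans (lerD (IH cmN) (_ : f N <= u N)) _; last first.
    lra.
  rewrite fE /u; apply: le_trans (ler_norm _) _; rewrite !normrM ler_wpM2l //.
  rewrite (ger0_norm (x := 16 ^+ N)) ?exprn_ge0 // -expr2.
  have -> : 16 = 4 ^+ 2 :> R by rewrite -natrX.
  rewrite -exprM mulnC exprM; apply: lerXn2r; rewrite ?nnegrE ?exprn_ge0 //.
  by apply: point_poly_bound; rewrite -ltnS.
(* For [m = N] the tail is smaller than [- w], against [tail]. *)
have /cvgrPdist_lt/(_ (- w)) := cu; rewrite oppr_gt0 => /(_ w0) [N _ /(_ (c + N).+1)].
have cN : (N <= (c + N).+1)%N by rewrite ltnW // ltnS leq_addl.
move=> /(_ cN) /=; have := tail N => h; rewrite ltNge => /negP; apply.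
by apply: le_trans (ler_norm _); lra.
Qed.

End PointEvaluation.

(** * Signs of the masses and the conclusion *)

Lemma omega_massE (R : realType) (a : R) (F : {fset nat}) x : omega_mass a F x =
  exp_coeff a x * ((Omega a F).[x%:R] * (Omega a F).[x.+1%:R])^-1.
Proof. by rewrite /omega_mass /exp_coeff /= !invfM; ring. Qed.

Lemma omega_mass_not_ge0 (R : realType) (a : R) (F : {fset nat}) :
  a < 0 -> (forall n : nat, (Omega a F).[n%:R] != 0) ->
  ~ forall n, 0 <= omega_mass a F n.
Proof.
move=> a0 On mass0.
have O0 : Omega a F != 0 by apply: contraNneq (On 0%N) => ->; rewrite horner0.
have [N _ ON] := horner_eventually O0.
(* An odd index beyond [N]: the power of [a] is negative while the product of the two values of
   [Omega] is positive. *)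
have := mass0 N.*2.+1; rewrite omega_massE leNgt => /negP; apply.
rewrite pmulr_llt0 ?invr_gt0 ?ON //; last by rewrite -addnn -addnS leq_addr.
rewrite /exp_coeff /= pmulr_llt0 ?invr_gt0 ?ltr0n ?fact_gt0 //.
by rewrite exprn_odd_lt0 //= odd_double.
Qed.

(** Nonnegativity of [annihilator] on the naturals is the link between the masses and the parity
    condition. *)
Lemma omega_mass_ge0P (R : realType) (a : R) (F : {fset nat}) : 0 < a ->
  (forall f : nat, f \in F -> (0 < f)%N) ->
  (forall n : nat, (Omega a F).[n%:R] != 0) ->
  (forall n, 0 <= omega_mass a F n) <-> admissible F.
Proof.
move=> a0 F0 On.
have massO n : (0 <= omega_mass a F n) =
    (0 <= (Omega a F).[n%:R] * (Omega a F).[n.+1%:R]).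
  by rewrite omega_massE pmulr_rge0 ?exp_coeff_gt0 // invr_ge0.
apply: iff_trans (iff_sym (admissibleP F0)).
apply: iff_trans (prod_subr_ge0P R F); split => H n.
  rewrite -annihilatorE; apply: (poisson_sq_ge0_nat a0).
  by apply: poisson_annihilator_ge0 => // m; rewrite -massO.
by rewrite massO; apply: annihilator_sq_ge0 => // m; rewrite annihilatorE.
Qed.

Theorem theorem4p4 (R : realType) (a : R) (F : {fset nat})
    (a_neq0 : a != 0)
    (F_pos : forall f : nat, f \in F -> (0 < f)%N)
    (Omega_neq0 : forall n : nat, (Omega a F).[n%:R] != 0) :
  exists omega : {charge set (measurableTypeR R) -> \bar R},
    [/\ is_discrete_charge (omega_mass a F) omega,
        orthogonal_family omega (sigmaF F) (xcharlier a F),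
        (a < 0 -> ~ positive_charge omega) &
        (0 < a -> (positive_charge omega <-> admissible F))].
Proof.
have cw := exp_dominated_series (exp_dominated_omega_mass Omega_neq0).
have [omega momega] := discrete_charge_exists cw.
have posP := positive_discrete_chargeP cw momega.
exists omega; split => // [|a0 /posP|a0].
- exact: discrete_charge_orthogonal.
- exact: omega_mass_not_ge0.
- exact: iff_trans posP (omega_mass_ge0P a0 F_pos Omega_neq0).
Qed.
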